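(* Let $X$ be a finite alphabet, let $w\in (X\cup X^{-1})^*$ be a sparse word and let $M=\mathrm{Inv}\langle X \mid w=1\rangle$. Then: (1) The language of words in $(X\cup X^{-1})^*$ equal to $1$ in $M$ is deterministic context-free. (2) The language of words in $(X\cup X^{-1})^*$ that represent elements of $M$ related to $1$ by Green's relation $\mathscr{R}$ in $M$ is deterministic context-free.
   Context: $X^{-1}$ is a disjoint set of formal inverses of the letters of $X$, with $(x^{-1})^{-1}=x$, and $(X\cup X^{-1})^*$ is the free monoid on $X\cup X^{-1}$; $l(\cdot)$ denotes word length. $\mathrm{Inv}\langle X\mid w=1\rangle$ is the inverse monoid presented by generators $X$ and the single relation $w=1$, i.e. the quotient of the free inverse monoid on $X$ by the congruence generated by $w=1$. In an inverse monoid, $s\,\mathscr{R}\,t$ iff $ss^{-1}=tt^{-1}$. Cyclic subwords. Let $w=a_0\cdots a_{n-1}$ with each $a_i\in X\cup X^{-1}$. A cyclic subword $q=w(i,j,\epsilon)$ of $w$, where $i,j\in\mathbb{Z}/n\mathbb{Z}$ and $\epsilon\in\{1,-1\}$, is a nonempty word of length at most $n-1$ of the form $q=a_i a_{i+1}\cdots a_{j-1}$ if $\epsilon=1$, and $q=a_{i-1}^{-1}a_{i-2}^{-1}\cdots a_j^{-1}$ if $\epsilon=-1$ (indices mod $n$). Its zone is the subset $\mathrm{zone}(q)=\{i,i+\epsilon,i+2\epsilon,\dots,j\}$ of $\mathbb{Z}/n\mathbb{Z}$ (the zone is attached to the triple $(i,j,\epsilon)$, not only to the word). Sparse. The word $w$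 is sparse if $w$ is freely reduced, $l(w)>1$, and whenever $(q_k,q_k')=(w(i_k,j_k,\epsilon_k),w(i_k',j_k',\epsilon_k'))$, $k=1,2$, are two pairs of cyclic subwords of $w$ satisfying $q_k=q_k'$ in $(X\cup X^{-1})^*$, $\mathrm{zone}(q_k)\neq\mathrm{zone}(q_k')$ and $0\in\mathrm{zone}(q_k')$ for $k=1,2$, then: (sparse 1) $\mathrm{zone}(q_1)\cap\mathrm{zone}(q_2')=\emptyset=\mathrm{zone}(q_1')\cap\mathrm{zone}(q_2)$; and (sparse 2) either $\mathrm{zone}(q_1)\cap\mathrm{zone}(q_2)=\emptyset$, or both $\epsilon_1\epsilon_1'=\epsilon_2\epsilon_2'$ and $i_1-\epsilon_1\epsilon_1'i_1'=i_2-\epsilon_2\epsilon_2'i_2' \bmod n$. *)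

(* Defs.v *)
From HB Require Import structures.
From mathcomp Require Import all_boot all_order all_algebra.
From Stdlib Require Import Relation_Operators.

Set Implicit Arguments.
Unset Strict Implicit.
Unset Printing Implicit Defensive.

Import GRing.Theory.

(* (x, true) is the generator x and (x, false) its formal inverse. *)
Definition letter (X : finType) : finType := (X * bool)%type.
Definition word (X : finType) := seq (letter X).

Definition inv_letter (X : finType) (a : letter X) : letter X := (a.1, ~~ a.2).
Definition inv_word (X : finType) (u : word X) : word X :=
  rev (map (@inv_letter X) u).

Definition freely_reduced (X : finType) (u : word X) : bool :=
  sorted (fun a b => b != inv_letter a) u.

Inductive generated_congruence (T : Type) (r : seq T -> seq T -> Prop) :
  seq T -> seq T -> Prop :=
| gc_base u v : r u v -> generated_congruence r u v
| gc_refl u : generated_congruence r u u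
| gc_sym u v : generated_congruence r u v -> generated_congruence r v u
| gc_trans u v t :
    generated_congruence r u v -> generated_congruence r v t ->
    generated_congruence r u t
| gc_mul u u' v v' :
    generated_congruence r u u' -> generated_congruence r v v' ->
    generated_congruence r (u ++ v) (u' ++ v').

(* The congruence generated by these pairs is the Vagner congruence, whose
   quotient is the free inverse monoid on X. *)
Inductive vagner (X : finType) : word X -> word X -> Prop :=
| vagner_regular u : vagner (u ++ inv_word u ++ u) u
| vagner_commute u v :
    vagner (u ++ inv_word u ++ v ++ inv_word v)
           (v ++ inv_word v ++ u ++ inv_word u).

(* [inv_pres_eq w u v]: u and v represent the same element of
   Inv<X | w = 1>. *)
Definition inv_pres_eq (X : finType) (w : word X) : word X -> word X -> Prop :=
  generated_congruence
    (fun u v => vagner u v \/ (u = w /\ v = [::])).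

Definition greenR (X : finType) (w u v : word X) : Prop :=
  inv_pres_eq w (u ++ inv_word u) (v ++ inv_word v).

Local Open Scope ring_scope.

(* Positions in w live in 'Z_(size w), which is Z/(size w)Z only when
   1 < size w; [sparse] includes this hypothesis.  The field [cpos] is true
   when epsilon = 1 and false when epsilon = -1. *)
Record ctriple (n : nat) :=
  CTriple { cstart : 'Z_n; cend : 'Z_n; cpos : bool }.

Definition ceps (n : nat) (q : ctriple n) : int := if cpos q then 1 else -1.

(* The representative in [0, n - 1] of epsilon * (j - i). *)
Definition clength (n : nat) (q : ctriple n) : nat :=
  if cpos q then (cend q - cstart q)%R else (cstart q - cend q)%R.

Definition cyclic_subword (n : nat) (q : ctriple n) : bool :=
  (0 < clength q <= n.-1)%N.

Definition zone (n : nat) (q : ctriple n) : {set 'Z_n} :=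
  [set cstart q + (ceps q)%:~R * k%:R | k : 'I_(clength q).+1].

Definition coffset (n : nat) (q q' : ctriple n) : 'Z_n :=
  cstart q - (ceps q * ceps q')%:~R * cstart q'.

Section CyclicSubwords.
Variables (X : finType) (w : word X).
Local Notation n := (size w).
Implicit Types q : ctriple n.

(* a_i ... a_(j-1) is a prefix of the rotation a_i a_(i+1) ... a_(i-1) of w;
   a_(i-1)^-1 ... a_j^-1 is the inverse of a_j ... a_(i-1). *)
Definition cword q : word X :=
  if cpos q then take (clength q) (rot (cstart q) w)
  else inv_word (take (clength q) (rot (cend q) w)).

Definition sparse_pair q q' : Prop :=
  [/\ cyclic_subword q, cyclic_subword q', cword q = cword q',
      zone q <> zone q' & 0 \in zone q'].

Definition sparse : Prop :=
  [/\ freely_reduced w, (1 < n)%N &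
      forall q1 q1' q2 q2' : ctriple n,
        sparse_pair q1 q1' -> sparse_pair q2 q2' ->
        (zone q1 :&: zone q2' = set0 /\ zone q1' :&: zone q2 = set0) /\
        (zone q1 :&: zone q2 = set0 \/
         (ceps q1 * ceps q1' = ceps q2 * ceps q2' /\
          coffset q1 q1' = coffset q2 q2'))].

End CyclicSubwords.

Local Close Scope ring_scope.

(* In [dpda_trans q o g] the input is a letter if [o = Some a] and the move
   is an epsilon-move if [o = None]; the top stack symbol g is replaced by
   the returned sequence, whose head is the new top. *)
Record dpda (S : finType) := DPDA {
  dpda_state : finType;
  dpda_stack : finType;
  dpda_start : dpda_state;
  dpda_bottom : dpda_stack;
  dpda_final : {set dpda_state};
  dpda_trans :
    dpda_state -> option S -> dpda_stack ->
    option (dpda_state * seq dpda_stack);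
  dpda_det : forall q g, dpda_trans q None g <> None ->
    forall a, dpda_trans q (Some a) g = None
}.

(* State, remaining input, stack (top first). *)
Definition dpda_config (S : finType) (A : dpda S) : Type :=
  (dpda_state A * seq S * seq (dpda_stack A))%type.

Inductive dpda_step (S : finType) (A : dpda S) :
  dpda_config A -> dpda_config A -> Prop :=
| dpda_read q a u g s p h : dpda_trans q (Some a) g = Some (p, h) ->
    dpda_step (q, a :: u, g :: s) (p, u, h ++ s)
| dpda_eps q u g s p h : dpda_trans q None g = Some (p, h) ->
    dpda_step (q, u, g :: s) (p, u, h ++ s).

Definition dpda_accepts (S : finType) (A : dpda S) (u : seq S) : Prop :=
  exists (q : dpda_state A) (s : seq (dpda_stack A)),
    q \in dpda_final A /\
    clos_refl_trans _ (@dpda_step S A)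
      (dpda_start A, u, [:: dpda_bottom A]) (q, [::], s).

Definition deterministic_context_free (S : finType) (L : seq S -> Prop) : Prop :=
  exists A : dpda S, forall u, dpda_accepts A u <-> L u.

(* Main.v *)
Require Import Defs.
From mathcomp Require Import all_boot.
From mathcomp Require Import all_algebra.
From mathcomp Require Import zify.
From Stdlib Require Import Setoid Relation_Operators Operators_Properties.

(** Let n be the length of [w] and M the monoid Inv<X | w = 1>.  The proof
    describes the Schuetzenberger graph of 1 in M, the deterministic graph
    whose vertices are the elements R-related to 1, so explicitly that its
    vertices are the configurations of a pushdown automaton.

    Suppose that the letters act on a set by partial injections, inverse
    letters by inverse injections, and that [w] acts as the identity.  Then
    the action factors through M, so every word equal to 1 fixes each vertex.
    If moreover each vertex [v] carries a word [rep v], empty at the root,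
    such that [rep v ++ [:: a]] equals [rep t] in M for each edge from [v] to
    [t] labelled [a], then a word which leads from the root to [v] equals
    [rep v] in M.  Hence the words equal to 1 are the labels of the loops at
    the root.  As a word [u] is readable at the root exactly when
    [u ++ inv_word u] labels a loop there, the words R-related to 1 are those
    readable at the root ([equiv1P], [greenR1P]).

    Such a graph arises from one cycle labelled [w] by attaching a new cycle
    labelled [w] at each vertex and folding, that is, identifying edges with
    the same origin and label, forever.  Sparseness controls the folding.
    When a cycle is attached at position [p] of another one, the two are
    identified along the pairs of arcs that start at [p] and at 0 and carry
    equal labels; these arcs are pairs of equal cyclic subwords, the second
    with 0 in its zone.  Condition (sparse 1) says that an arc of a cycle along
    which it is glued to its parent never meets an arc along which a child is
    glued to it, and (sparse 2) that arcs along which different children are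
    glued are disjoint and that gluing is injective.  So a vertex is
    determined by the list of the positions at which cycles were attached on
    the way to it, the last position first, and an edge changes at most the
    last two entries of the list.  Keeping the last entry in the state and the
    others on the stack, a deterministic automaton that makes one move per
    letter follows the edges: it accepts the first language when its final
    state means the empty list, and the second when all states are final.

    The argument breaks down only for [w = [:: a; a]], where the attached
    cycle folds completely onto its parent; there the graph is a single cycle
    of length 2. *)

Set Implicit Arguments.
Unset Strict Implicit.
Unset Printing Implicit Defensive.

Import GRing.Theory.

(** * Right units of a one-relator inverse monoid *)

Lemma inv_letterK (X : finType) : involutive (@inv_letter X).
Proof. by case=> x b; rewrite /inv_letter /= negbK. Qed.

Lemma inv_letter_neq (X : finType) (a : letter X) : inv_letter a != a.
Proof. by case: a => x [] /=; apply/eqP => -[]. Qed.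

Section OneRelator.
Variables (X : finType) (w : word X).
Local Notation "u ≡ v" := (inv_pres_eq w u v) (at level 70).

Lemma equiv_cat u u' v v' : u ≡ u' -> v ≡ v' -> u ++ v ≡ u' ++ v'.
Proof. exact: gc_mul. Qed.

Lemma equiv_catl t u v : u ≡ v -> t ++ u ≡ t ++ v.
Proof. by apply: equiv_cat; exact: gc_refl. Qed.

Lemma equiv_catr t u v : u ≡ v -> u ++ t ≡ v ++ t.
Proof. by move=> uv; apply: equiv_cat uv _; exact: gc_refl. Qed.

Lemma equiv_relator : w ≡ [::].
Proof. by apply: gc_base; right. Qed.

Lemma equiv_regular u : u ++ inv_word u ++ u ≡ u.
Proof. by apply: gc_base; left; constructor. Qed.

Lemma equiv_commute u v :
  u ++ inv_word u ++ v ++ inv_word v ≡ v ++ inv_word v ++ u ++ inv_word u.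
Proof. by apply: gc_base; left; constructor. Qed.

Definition right_invertible u := exists v, u ++ v ≡ [::].

Lemma right_invertible_cat u v :
  right_invertible u -> right_invertible v -> right_invertible (u ++ v).
Proof.
move=> [u' uu'] [v' vv']; exists (v' ++ u').
apply: gc_trans uu'; rewrite -catA; apply: equiv_catl.
by rewrite catA; apply: (equiv_catr u') vv'.
Qed.

(** Since [u u^-1 u = u], if [v] is a right inverse of [u] then
    [u u^-1 = u u^-1 (u v) = u v = 1]. *)
Lemma right_invertibleE u : right_invertible u -> u ++ inv_word u ≡ [::].
Proof.
move=> [v uv]; apply: (gc_trans _ uv).
apply: gc_trans (_ : (u ++ inv_word u) ++ u ++ v ≡ _).
  by rewrite -{1}[u ++ inv_word u]cats0; apply/equiv_catl/gc_sym.
rewrite catA; apply: equiv_catr; rewrite -catA; exact: equiv_regular.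
Qed.

(** As idempotents commute,
    [u = (u v v^-1 u^-1) u = (u u^-1 u) (v v^-1) = u v v^-1]. *)
Lemma backtrack u v : right_invertible (u ++ v) -> (u ++ v) ++ inv_word v ≡ u.
Proof.
move=> /right_invertibleE uv1.
have inv_cat s t : inv_word (s ++ t) = inv_word t ++ inv_word s :> word X.
  by rewrite /inv_word map_cat rev_cat.
have invK s : inv_word (inv_word s) = s :> word X.
  by rewrite /inv_word map_rev revK mapK //; exact: inv_letterK.
have comm : (v ++ inv_word v) ++ inv_word u ++ u
    ≡ (inv_word u ++ u) ++ v ++ inv_word v.
  by have := equiv_commute v (inv_word u); rewrite invK !catA.
apply: gc_sym; apply: gc_trans (_ : ((u ++ v) ++ inv_word (u ++ v)) ++ u ≡ _).
  by rewrite -{1}[u]cat0s; apply/equiv_catr/gc_sym.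
rewrite inv_cat -!catA.
move: comm => /(equiv_catl u); rewrite -!catA => /gc_trans; apply.
have := equiv_catr (v ++ inv_word v) (equiv_regular u).
by rewrite -!catA.
Qed.

End OneRelator.

(** * Words as walks in a deterministic graph *)

Section Walks.
Variables (X : finType) (V : Type) (E : V -> letter X -> V -> Prop).

Fixpoint walk v (u : word X) v' : Prop :=
  if u is a :: u' then exists2 t, E v a t & walk t u' v' else v = v'.

Lemma walk_cat v u u' v' :
  walk v (u ++ u') v' <-> exists2 t, walk v u t & walk t u' v'.
Proof.
elim: u v => [|a u IHu] v /=.
  by split=> [|[_ <-]//]; exists v.
split=> [[t vt /IHu[s ts sv]]|[s [t vt ts] sv]].
  by exists s => //; exists t.
by exists t => //; apply/IHu; exists s.
Qed.

Hypothesis E_fun : forall v a t t', E v a t -> E v a t' -> t = t'.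
Hypothesis E_inv : forall v a t, E v a t -> E t (inv_letter a) v.

Lemma walk_fun v u t t' : walk v u t -> walk v u t' -> t = t'.
Proof.
elim: u v => [|a u IHu] v /=; first by move=> <-.
move=> [s vs st] [s' vs' st']; move: st'.
by rewrite -(E_fun vs vs'); apply: IHu.
Qed.

Lemma walk_inv v u t : walk v u t -> walk t (inv_word u) v.
Proof.
elim: u v => [|a u IHu] v /= => [->//|[s vs /IHu st]].
rewrite /inv_word /= rev_cons -cats1; apply/walk_cat; exists s => //=.
by exists v => //; apply: E_inv.
Qed.

Lemma walk_loop v u t :
  walk v (u ++ inv_word u) t <-> v = t /\ exists s, walk v u s.
Proof.
split=> [/walk_cat[s vs st]|[<- [s vs]]].
  by split; [apply: walk_fun (walk_inv vs) st | exists s].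
by apply/walk_cat; exists s => //; apply: walk_inv.
Qed.

Variables (w : word X) (root : V) (rep : V -> word X).
Hypothesis w_loop : forall v a t, E v a t -> walk v w v.
Hypothesis w_loop_root : walk root w root.
Hypothesis rep_root : rep root = [::].
Hypothesis E_rep :
  forall v a t, E v a t -> inv_pres_eq w (rep v ++ [:: a]) (rep t).

Lemma w_loop_walk v u t : walk v w v -> walk v u t -> walk t w t.
Proof.
elim: u v => [|a u IHu] v vw /=; first by move=> <-.
move=> [s vs]; exact: IHu (w_loop (E_inv vs)).
Qed.

(** Both Vagner relations hold for words acting by partial injections: a word
    followed by its inverse acts as a partial identity, and partial identities
    commute. *)
Lemma walk_equiv u u' v t :
  walk v w v -> inv_pres_eq w u u' -> walk v u t <-> walk v u' t.
Proof.
move=> vw uu'; elim: uu' v t vw => {u u'}.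
- move=> _ _ [[u|u u']|[-> ->]] v t vw.
  + rewrite catA walk_cat; split=> [[s /walk_loop[<- _]]//|vt].
    by exists v => //; apply/walk_loop; split=> //; exists t.
  + rewrite !catA -!(catA _ u') -!(catA _ u) !walk_cat.
    by split=> -[s /walk_loop[<- us] /walk_loop[<- u's]];
       exists v; apply/walk_loop.
  + by split=> [/(walk_fun vw)|/= <-].
- by [].
- by move=> u u' _ IH v t vw; rewrite IH.
- by move=> u u' u'' _ IH _ IH' v t vw; rewrite IH ?IH'.
- move=> u u' s s' _ IH _ IH' v t vw; rewrite !walk_cat.
  split=> -[x vx xt]; exists x.
  + exact/IH.
  + by apply/IH' => //; apply: w_loop_walk vw vx.
  + exact/IH.
  + by apply/IH' => //; apply: w_loop_walk vw vx.
Qed.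

Lemma walk_rep v u t : walk v u t -> inv_pres_eq w (rep v ++ u) (rep t).
Proof.
elim: u v => [|a u IHu] v /=; first by move=> <-; rewrite cats0; apply: gc_refl.
move=> [s vs /IHu]; apply: gc_trans; rewrite -cat1s catA.
exact/equiv_catr/E_rep.
Qed.

Lemma equiv1P u : inv_pres_eq w u [::] <-> walk root u root.
Proof.
split=> [u1|/walk_rep]; last by rewrite rep_root.
by apply/(walk_equiv _ w_loop_root u1).
Qed.

Lemma greenR1P u : greenR w u [::] <-> exists v, walk root u v.
Proof.
rewrite /greenR equiv1P walk_loop; split=> [[]//|]; by split.
Qed.

Variables (Q G : finType) (q0 : Q) (g0 : G).
Variable delta : Q -> letter X -> G -> option (Q * seq G).

Definition realtime_trans q (o : option (letter X)) g :=
  if o is Some a then delta q a g else None.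

Fact realtime_det q g : realtime_trans q None g <> None ->
  forall a, realtime_trans q (Some a) g = None.
Proof. by []. Qed.

Definition realtime_dpda F : dpda (letter X) :=
  @DPDA _ Q G q0 g0 F realtime_trans realtime_det.

(** [conf] turns vertices into configurations of the automaton; [delta_conf]
    says that the move for [a] follows the edge labelled [a]. *)
Variable conf : V -> Q * seq G.
Hypothesis conf_root : conf root = (q0, [:: g0]).
Hypothesis delta_conf : forall v, walk v w v -> exists g s,
  (conf v).2 = g :: s /\
  forall a, if delta (conf v).1 a g is Some r
            then exists2 t, E v a t & conf t = (r.1, r.2 ++ s)
            else forall t, ~ E v a t.

(** Each move of the automaton consumes a letter, so its runs are the walks of
    the graph seen through [conf]. *)
Lemma realtime_run F v u (q : Q) (s : seq G) : walk v w v ->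
  clos_refl_trans _ (@dpda_step _ (realtime_dpda F))
    ((conf v).1, u, (conf v).2) (q, [::], s) <->
  exists2 t, walk v u t & conf t = (q, s).
Proof.
move=> vw; split=> [/clos_rt_rt1n_iff|[t]].
  move e: (_, _, _) => c; move e': (_, _, s) => c' run.
  elim: run v u vw e e' => {c c'} [c|c c1 c' + _ IH] v u vw.
    by move=> <- [-> <- ->]; exists v; rewrite -?surjective_pairing.
  move=> st ec ec'; rewrite -{}ec in st.
  have [g [st' [ev mv]]] := delta_conf vw; rewrite ev in st.
  inversion st as [q1 a u1 g1 s1 p h tr|]; subst; last by [].
  move: (mv a) tr; rewrite /= => + tr; rewrite tr => -[t vt ct].
  have tw : walk t w t by apply: w_loop (E_inv vt).
  have [|x tx cx] := IH t u1 tw _ erefl; first by rewrite ct.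
  by exists x => //=; exists t.
elim: u v vw => [|a u IHu] v vw /=.
  by move=> -> ->; apply: rt_refl.
move=> [x vx xt] ct.
have xw : walk x w x by apply: w_loop (E_inv vx).
apply: rt_trans (IHu _ xw xt ct); apply: rt_step.
have [g [st' [ev mv]]] := delta_conf vw; move: (mv a); rewrite ev.
case e: (delta _ a g) => [[p h]|]; last by move/(_ _ vx).
move=> [x' /(E_fun vx) <- ->].
exact: (@dpda_read _ (realtime_dpda F)).
Qed.

Hypothesis conf_start : forall v, walk v w v -> (conf v).1 = q0 -> v = root.

(** The two languages need different final states: only [q0] for words equal
    to 1, as by [conf_start] it occurs at the root only, and all states for
    words R-related to 1. *)
Theorem graph_deterministic_context_free :
  deterministic_context_free (fun u : word X => inv_pres_eq w u [::]) /\
  deterministic_context_free (fun u : word X => greenR w u [::]).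
Proof.
split.
  exists (realtime_dpda [set q0]) => u; rewrite equiv1P /dpda_accepts.
  have /= run q s := realtime_run [set q0] u q s w_loop_root.
  rewrite conf_root in run.
  split=> [[q [s [/set1P-> /run[t ut ct]]]]|ut].
    suff tr : t = root by rewrite -{2}tr.
    by apply: conf_start (w_loop_walk w_loop_root ut) _; rewrite ct.
  exists q0, [:: g0]; rewrite inE; split=> //.
  by apply/run; exists root.
exists (realtime_dpda setT) => u; rewrite greenR1P /dpda_accepts.
have /= run q s := realtime_run setT u q s w_loop_root.
rewrite conf_root in run.
split=> [[q [s [_ /run[t ut _]]]]|[t ut]]; first by exists t.
exists (conf t).1, (conf t).2; rewrite inE; split=> //.
by apply/run; exists t; rewrite -?surjective_pairing.
Qed.

End Walks.

(** * The cycle labelled by the relator *)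

Section Cycle.
Local Open Scope ring_scope.
Variables (X : finType) (w : word X) (x0 : letter X).
Local Notation n := (size w).
Hypothesis n_gt1 : (1 < n)%N.
Implicit Types (k m p : 'Z_n) (b : bool).

Definition sgn b : 'Z_n := if b then 1 else -1.

(** The label of the edge that leaves position [k] of the cycle in the
    direction of [w] if [b], against it otherwise. *)
Definition label k b : letter X :=
  if b then nth x0 w k else inv_letter (nth x0 w (k - 1)%R).

Lemma sgnN b : sgn (~~ b) = - sgn b.
Proof. by case: b; rewrite /= ?opprK. Qed.

Lemma sgn_sq b : sgn b * sgn b = 1.
Proof. by case: b; rewrite /sgn ?mulrNN mulr1. Qed.

(** In Z/2Z the two directions lead to the same vertex. *)
Lemma sgn_inj : (2 < n)%N -> injective sgn.
Proof.
move=> n_gt2.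
have neq : (1 : 'Z_n) <> -1.
  move/eqP; rewrite -subr_eq0 opprK -mulr2n.
  by move/eqP/(congr1 (@nat_of_ord _)); rewrite val_Zp_nat //= modn_small.
by move=> [] [] //= e; case: neq.
Qed.

Lemma label_back k b : label (k + sgn b) (~~ b) = inv_letter (label k b).
Proof. by case: b; rewrite /label /sgn ?addrK ?inv_letterK. Qed.

Lemma val_natZ (m : nat) : (m < n)%N -> ((m%:R : 'Z_n) : nat) = m.
Proof. by move=> mn; rewrite val_Zp_nat // modn_small. Qed.

Lemma ltn_Z k : (k < n)%N.
Proof. by rewrite -{2}(Zp_cast n_gt1). Qed.

Lemma val_succ k : ((k + 1)%R : nat) = (k.+1 %% n)%N.
Proof. by rewrite -{1}[k]natr_Zp natr1 val_Zp_nat. Qed.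

Lemma relator_loop (V : Type) (E : V -> letter X -> V -> Prop)
    (f : 'Z_n -> V) :
  (forall k, E (f k) (label k true) (f (k + 1))) -> walk E (f 0) w (f 0).
Proof.
move=> Ef.
have pre (m : nat) : (m <= n)%N -> walk E (f 0) (take m w) (f m%:R).
  elim: m => [|m IHm] mn; first by rewrite take0.
  rewrite (take_nth x0) // -cats1; apply/walk_cat.
  exists (f m%:R); first exact/IHm/ltnW.
  exists (f m.+1%:R) => //=; rewrite -[m.+1]addn1 natrD.
  by have := Ef m%:R; rewrite /label val_natZ.
have := pre n (leqnn _); rewrite take_size.
suff -> : (n%:R : 'Z_n) = 0 by [].
by apply: ord_inj; rewrite val_Zp_nat // modnn.
Qed.

Lemma take_equiv_fwd u k :
  inv_pres_eq w ((u ++ take k w) ++ [:: label k true]) (u ++ take (k + 1)%R w).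
Proof.
rewrite -catA cats1 /label -take_nth ?ltn_Z //; apply: equiv_catl.
case: (ltnP k.+1 n) => kn.
  suff -> : (k + 1 : 'Z_n) = k.+1 :> nat by apply: gc_refl.
  by rewrite val_succ modn_small.
rewrite take_oversize //.
have -> : k + 1 = 0.
  apply: ord_inj; rewrite val_succ.
  have -> : k.+1 = n by apply/eqP; rewrite eqn_leq kn ltn_Z.
  by rewrite modnn.
by rewrite take0; apply: equiv_relator.
Qed.

Lemma right_invertible_take u k :
  right_invertible w u -> right_invertible w (u ++ take k w).
Proof.
move=> u1; apply: right_invertible_cat => //.
by exists (drop k w); rewrite cat_take_drop; apply: equiv_relator.
Qed.

(** In a backward step from [k + 1] to [k], the last letter of
    [take (k + 1) w] is cancelled, which is legitimate because
    [u ++ take (k + 1) w] is right invertible. *)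
Lemma take_equiv u k b : right_invertible w u ->
  inv_pres_eq w ((u ++ take k w) ++ [:: label k b])
                (u ++ take (k + sgn b)%R w).
Proof.
move=> u1; case: b; first exact: take_equiv_fwd.
have {1 2}-> : k = k + sgn false + sgn true by rewrite /sgn subrK.
move: (k + sgn false) => {}k.
rewrite [label _ false](label_back k true).
have fwd := take_equiv_fwd u k.
apply: gc_trans (equiv_catr _ (gc_sym fwd)) _.
have [v e] := right_invertible_take (k + 1) u1.
apply: (@backtrack X w (u ++ take k w) [:: label k true]).
by exists v; apply: gc_trans (equiv_catr v fwd) e.
Qed.
End Cycle.

(** * Gluing a cycle onto its parent *)

Lemma connect_preserves (T : finType) (e : rel T) (P : T -> Prop) x y :
  (forall y z, e y z -> P y -> P z) -> P x -> connect e x y -> P y.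
Proof.
move=> eP Px /connectP[s + ->]; elim: s x Px => //= z s IHs x Px /andP[xz].
exact/IHs/(eP x).
Qed.

Section Gluing.
Local Open Scope ring_scope.
Variables (X : finType) (w : word X) (x0 : letter X).
Local Notation I := 'Z_(size w).
Local Notation label := (@label X w x0).
Local Notation sgn := (@sgn X w).
Implicit Types (p m k j h : I) (b : bool) (c d v : seq I).

(** One step of folding two copies of the cycle: if position [x.1] of the first
    is identified with [x.2] of the second and edges with the same label leave
    there, then the ends of these edges are identified too. *)
Definition same_step (x y : I * I) : bool :=
  [exists b, exists b', [&& label x.1 b == label x.2 b',
     y.1 == x.1 + sgn b & y.2 == x.2 + sgn b']].

Lemma same_stepP x y : reflect
  (exists b b', [/\ label x.1 b = label x.2 b',
     y.1 = x.1 + sgn b & y.2 = x.2 + sgn b']) (same_step x y).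
Proof.
apply: (iffP existsP) => [[b /existsP[b' /and3P[/eqP ? /eqP ? /eqP ?]]]|].
  by exists b, b'.
by move=> [b [b' [? ? ?]]]; exists b; apply/existsP; exists b'; apply/and3P;
  split; apply/eqP.
Qed.

(** When position 0 of a new cycle is attached at position [p] of a cycle,
    folding the two identifies position [m] of the old one with position [k]
    of the new one. *)
Definition glued p m k : bool := connect same_step (p, 0) (m, k).

(** Whether folding identifies more than the position of attachment. *)
Definition seam p : bool := [exists b, exists b', label p b == label 0 b'].

Lemma seamP p :
  reflect (exists b b', label p b = label 0 b') (seam p).
Proof.
apply: (iffP existsP) => [[b /existsP[b' /eqP]]|[b [b' e]]].
  by exists b, b'.
by exists b; apply/existsP; exists b'; apply/eqP.
Qed.

Lemma glued_base p : glued p p 0.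
Proof. exact: connect0. Qed.

Lemma glued_step p m k b b' : glued p m k -> label m b = label k b' ->
  glued p (m + sgn b) (k + sgn b').
Proof.
move=> /connect_trans + e; apply; apply/connect1/same_stepP.
by exists b, b'.
Qed.

Lemma glued_no_seam p m k : glued p m k -> ~~ seam p -> m = p /\ k = 0.
Proof.
move=> + /negP ns.
move=> g; suff [-> ->] : (m, k) = (p, 0) by [].
apply: (connect_preserves (P := fun x => x = (p, 0)) _ _ g) => // y z.
move=> /same_stepP[b [b' [+ _ _]]] ey; rewrite {}ey /= => e.
by case: ns; apply/seamP; exists b, b'.
Qed.
End Gluing.

(** * The tree of cycles *)

Section TreeOfCycles.
Local Open Scope ring_scope.
Variables (X : finType) (w : word X) (x0 : letter X).
Hypothesis n_gt1 : (1 < size w)%N.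
Local Notation I := 'Z_(size w).
Local Notation label := (@label X w x0).
Local Notation sgn := (@sgn X w).
Local Notation glued := (@glued X w x0).
Local Notation seam := (@seam X w x0).
Implicit Types (p m k j h : I) (b : bool) (c d v : seq I).

(** These are the consequences of sparseness on which the tree rests.
    [label_inj] says that [w] is cyclically reduced; [glued_inj] and
    [glued_fun] that folding a child onto its parent does not identify two
    positions of the same cycle; [glued_neq0] that a child does not reach
    position 0, where its parent is attached; [seam_disjoint] that no position
    is glued along seams both to the parent and to a child; [seam_unique] that
    none is glued along seams to two children. *)
Hypothesis label_inj : forall k, injective (label k).
Hypothesis glued_inj : forall p m m' k,
  p != 0 -> glued p m k -> glued p m' k -> m = m'.
Hypothesis glued_fun : forall p m k k',
  p != 0 -> glued p m k -> glued p m k' -> k = k'.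
Hypothesis glued_neq0 : forall p m k, p != 0 -> glued p m k -> m != 0.
Hypothesis seam_disjoint : forall p p' m k m',
  p != 0 -> p' != 0 -> seam p -> seam p' ->
  glued p m k -> glued p' m' m -> False.
Hypothesis seam_unique : forall p p' m k k',
  p != 0 -> p' != 0 -> seam p -> seam p' ->
  glued p m k -> glued p' m k' -> p = p'.

(** A vertex is the list of the positions at which cycles were attached, the
    last one first, and the same list names the cycle attached at this vertex.
    A position of the cycle [c] is fresh if it is not already a position of
    the parent of [c]; for the first cycle, 0 is excluded because it is the
    root, written [[::]]. *)
Definition fresh c k : bool :=
  if c is h :: _ then [forall m, ~~ glued h m k] else k != 0.

Fixpoint valid c : bool :=
  if c is p :: c' then fresh c' p && valid c' else true.

(** The vertex at position [k] of the cycle [c].  The default value 0 does not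
    occur: if [k] is not fresh, some [m] is glued to it. *)
Definition vertex c k : seq I :=
  if fresh c k then k :: c
  else if c is p :: c' then odflt 0 [pick m | glued p m k] :: c' else [::].

Lemma fresh_neq0 c k : fresh c k -> k != 0.
Proof.
case: c => [|h c] //= /forallP/(_ h); apply: contra => /eqP->.
exact: glued_base.
Qed.

Lemma valid_neq0 p c : valid (p :: c) -> p != 0.
Proof. by case/andP=> /fresh_neq0. Qed.

Variant vertex_spec c k : seq I -> Prop :=
| VertexFresh of fresh c k : vertex_spec c k (k :: c)
| VertexRoot of c = [::] & k = 0 : vertex_spec c k [::]
| VertexGlued p c' m of c = p :: c' & glued p m k : vertex_spec c k (m :: c').

Lemma vertexP c k : vertex_spec c k (vertex c k).
Proof.
rewrite /vertex; case: ifP => [|/negbT]; first exact: VertexFresh.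
case: c => [|p c] /=; first by rewrite negbK => /eqP; apply: VertexRoot.
rewrite negb_forall => /existsP[m]; rewrite negbK => g.
case: pickP => [m' g'|/(_ m)]; last by rewrite g.
exact: VertexGlued g'.
Qed.

Lemma vertex_glued p m k c :
  p != 0 -> glued p m k -> vertex (p :: c) k = m :: c.
Proof.
move=> p0 g; case: vertexP => [/forallP/(_ m)||p' c' m' [<- <-] g'] //.
  by rewrite g.
by rewrite (glued_inj p0 g g').
Qed.

Lemma vertex0 v : valid v -> vertex v 0 = v.
Proof.
case: v => [|p v] vv; first by rewrite /vertex /fresh eqxx.
exact: vertex_glued (valid_neq0 vv) (glued_base _ _).
Qed.

(** A position glued along a seam to a child belongs neither to a seam with the
    parent nor, not being 0, to a parent met at a single position. *)
Lemma seam_fresh p m k c : p != 0 -> seam p -> glued p m k -> valid c ->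
  fresh c m.
Proof.
move=> p0 sp g; have m0 := glued_neq0 p0 g.
case: c => //= h c /valid_neq0 h0; apply/forallP => m'; apply/negP => g'.
have [sh|/(glued_no_seam g')[_ e]] := boolP (seam h).
  exact: seam_disjoint g g'.
by rewrite e eqxx in m0.
Qed.

Lemma valid_vertex c k : valid c -> valid (vertex c k).
Proof.
move=> vc; case: vertexP vc => [/= -> //|-> //|p c' m -> g].
move=> vc; have p0 := valid_neq0 vc; case/andP: vc => fp vc'.
suff fm : fresh c' m by apply/andP.
have [sp|/(glued_no_seam g)[-> _]//] := boolP (seam p).
exact: seam_fresh p0 sp g vc'.
Qed.

Lemma glued_seam p m k b b' : glued p m k -> label m b = label k b' -> seam p.
Proof.
move=> g; apply: contra_eqT => np; have [-> ->] := glued_no_seam g np.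
by apply: contra np => /eqP e; apply/seamP; exists b, b'.
Qed.

(** The vertex [p :: c] on its own cycle [c] and on a cycle [j :: c] glued to
    it there: folding has identified the ends of edges with the same label.
    The case [j = p], [k = 0] is the cycle attached at the vertex itself. *)
Lemma own_glued_step p k j c b b' : valid (j :: c) ->
  glued j p k -> label p b = label k b' ->
  vertex c (p + sgn b) = vertex (j :: c) (k + sgn b').
Proof.
move=> vc g e; have j0 := valid_neq0 vc.
have g' := glued_step g e; rewrite (vertex_glued _ j0 g').
rewrite /vertex (seam_fresh j0 (glued_seam g e) g') //.
by case/andP: vc.
Qed.

(** If the cycles are different, they are two children of [c] that meet at the
    same vertex.  They cannot both have a seam, so one of them, [i] in the
    proof, meets [c] only at its position 0.  If an edge of the other at
    position [q'] had the same label as an edge of [i] at 0, then a cycle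
    attached at [q'] would have a seam there, though [q'] is glued to the
    parent along a seam. *)
Lemma glued_glued_step p k k' j j' c b b' :
  valid (j :: c) -> valid (j' :: c) -> glued j p k -> glued j' p k' ->
  label k b = label k' b' ->
  vertex (j :: c) (k + sgn b) = vertex (j' :: c) (k' + sgn b').
Proof.
move=> vj vj' g g' e.
have j0 := valid_neq0 vj; have j0' := valid_neq0 vj'.
have [jj'|/eqP jj'] := eqVneq j j'.
  rewrite -jj' in g' *; move: e; rewrite (glued_fun j0 g g').
  by move=> /label_inj->.
have key i i' (q q' : I) bi bi' : i' != 0 -> i != i' -> ~~ seam i -> 
    glued i p q -> glued i' p q' -> label q bi = label q' bi' -> False.
  move=> i0' ii' ni gi gi' ei; have [pi q0] := glued_no_seam gi ni.
  have [si'|/(glued_no_seam gi')[pi' _]] := boolP (seam i'); last first.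
    by rewrite -pi pi' eqxx in ii'.
  have q0' : q' != 0.
    apply: contraNneq ii' => q0'; rewrite q0' in gi'.
    by rewrite -pi (glued_inj i0' gi' (glued_base _ _)).
  apply: (seam_disjoint q0' i0' _ si' (glued_base _ q') gi').
  by apply/seamP; exists bi', bi; rewrite -ei q0.
have [sj|nj] := boolP (seam j); last first.
  by case: (key j j' k k' b b') => //; apply/eqP.
have [sj'|nj'] := boolP (seam j'); last first.
  by case: (key j' j k' k b' b) => //; apply/eqP/nesym.
by case: jj'; apply: seam_unique g g'.
Qed.

(** The tree of cycles is deterministic: no folding is left to do. *)
Lemma vertex_step c c' k k' b b' : valid c -> valid c' ->
  vertex c k = vertex c' k' -> label k b = label k' b' ->
  vertex c (k + sgn b) = vertex c' (k' + sgn b').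
Proof.
move=> vc vc'.
case: (vertexP c k) => [fk|c0 k0|p d m cE g];
  case: (vertexP c' k') => [fk'|c0' k0'|p' d' m' cE' g'] //.
- by move=> [<- <-] /label_inj->.
- move=> [-> ->]; rewrite cE' in vc' *; exact: own_glued_step.
- by rewrite k0 k0' c0 c0' => _ /label_inj->.
- move=> [<- <-] e; apply/esym; rewrite cE in vc *.
  by apply: own_glued_step => //; rewrite e.
- move=> [mm' dd']; rewrite cE cE' -dd' -mm' in vc vc' g' *.
  exact: glued_glued_step g g'.
Qed.

Definition edge v a t := exists c k b,
  [/\ valid c, v = vertex c k, a = label k b & t = vertex c (k + sgn b)].

Lemma edge_fun v a t t' : edge v a t -> edge v a t' -> t = t'.
Proof.
move=> [c [k [b [vc -> -> ->]]]] [c' [k' [b' [vc' vE e ->]]]].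
exact: vertex_step.
Qed.

Lemma edge_inv v a t : edge v a t -> edge t (inv_letter a) v.
Proof.
move=> [c [k [b [vc -> -> ->]]]]; exists c, (k + sgn b), (~~ b); split=> //.
  by rewrite label_back.
by rewrite sgnN addrK.
Qed.

Lemma edge_valid v a t : edge v a t -> valid v.
Proof. by move=> [c [k [b [vc -> _ _]]]]; apply: valid_vertex. Qed.

(** Every vertex is position 0 of the cycle attached at it. *)
Lemma valid_loop v : valid v -> walk edge v w v.
Proof.
move=> vv; have := @relator_loop X w x0 n_gt1 _ edge (vertex v).
by rewrite vertex0 //; apply=> k; exists v, k, true.
Qed.

Lemma loop_valid v : walk edge v w v -> valid v.
Proof.
suff walk_valid u t : (1 < size u)%N -> walk edge v u t -> valid v.
  exact: walk_valid n_gt1.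
by case: u => //= a u _ [s /edge_valid].
Qed.

(** The word read from the root to a vertex when each cycle on the way is
    followed forward from its position 0. *)
Fixpoint tree_word c : word X :=
  if c is k :: c' then tree_word c' ++ take k w else [::].

Lemma tree_word_invertible c : right_invertible w (tree_word c).
Proof.
elim: c => [|k c IHc] /=; first by exists [::]; apply: gc_refl.
exact: right_invertible_take.
Qed.

(** The identity holds for [m = p] and [k = 0], where both sides are
    [tree_word (p :: c)], and it persists when the same letter is read on both
    cycles. *)
Lemma glued_equiv p m k c : glued p m k ->
  inv_pres_eq w (tree_word c ++ take m w) (tree_word (p :: c) ++ take k w).
Proof.
pose same (y : I * I) :=
  inv_pres_eq w (tree_word c ++ take y.1 w) (tree_word (p :: c) ++ take y.2 w).
apply: (connect_preserves (P := same)); last first.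
  by rewrite /same take0 cats0; apply: gc_refl.
rewrite /same => y z /same_stepP[b [b' [e -> ->]]] IH.
have s1 := take_equiv x0 n_gt1 y.1 b (tree_word_invertible c).
have s2 := take_equiv x0 n_gt1 y.2 b' (tree_word_invertible (p :: c)).
apply: gc_trans (gc_sym s1) _; apply: gc_trans s2; rewrite e.
exact: equiv_catr.
Qed.

Lemma tree_word_vertex c k :
  inv_pres_eq w (tree_word (vertex c k)) (tree_word c ++ take k w).
Proof.
case: vertexP => [_|-> ->|p c' m -> g]; [exact: gc_refl| |exact: glued_equiv].
by rewrite take0; apply: gc_refl.
Qed.

Lemma edge_tree_word v a t : edge v a t ->
  inv_pres_eq w (tree_word v ++ [:: a]) (tree_word t).
Proof.
move=> [c [k [b [_ -> -> ->]]]].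
apply: gc_trans (equiv_catr _ (tree_word_vertex c k)) _.
apply: gc_trans (gc_sym (tree_word_vertex c _)).
exact/take_equiv/tree_word_invertible.
Qed.

(** The automaton sees only the last position [p] of a vertex and the list [d]
    of at most one entry that is on top of its stack.  The cycles through a
    vertex [p :: d] are [d] itself and children [j :: d], among them the one
    attached at the vertex; a candidate [z] for an edge consists of such a
    cycle, given by [None] or [Some j], a position on it and a direction. *)
Definition local_cycle (d : seq I) (z : option I * I * bool) : seq I :=
  if z.1.1 is Some j then j :: d else d.

Definition local_edge (d v : seq I) (a : letter X) : option (seq I) :=
  if [pick z : option I * I * bool |
        [&& if z.1.1 is Some j then fresh d j else true,
            vertex (local_cycle d z) z.1.2 == v & a == label z.1.2 z.2]]
    is Some z then Some (vertex (local_cycle d z) (z.1.2 + sgn z.2)) else None.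

Lemma fresh_cat d r k : (d == [::]) ==> (r == [::]) ->
  fresh (d ++ r) k = fresh d k.
Proof. by case: d => //= /eqP->. Qed.

Lemma vertex_cat c r k : (c == [::]) ==> (r == [::]) ->
  vertex (c ++ r) k = vertex c k ++ r.
Proof.
move=> cr; rewrite /vertex fresh_cat //; case: ifP => // _.
by case: c cr => //= /eqP->.
Qed.

(** Below the visible part [d] the rest [r] of the list matters neither for
    freshness nor for the gluing, unless [d] is empty; then [r] is empty as
    well.  So following an edge commutes with appending [r]. *)
Lemma local_edgeP d v r a : (d == [::]) ==> (r == [::]) ->
  (v = [::] /\ d = [::]) \/ (exists p, v = p :: d) -> valid (v ++ r) ->
  if local_edge d v a is Some t
  then edge (v ++ r) a (t ++ r) /\ (t == [::]) ==> (r == [::])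
  else forall t, ~ edge (v ++ r) a t.
Proof.
move=> dr vd vvr.
have vdr : valid (d ++ r).
  case: vd vvr => [[-> -> //]|[p -> /=/andP[]//]].
have cr z : (local_cycle d z == [::]) ==> (r == [::]).
  by case: z => [[[j|] k] b].
rewrite /local_edge; case: pickP => [z /and3P[fz /eqP vE /eqP ->]|none].
  split; last first.
    by move: (cr z); case: vertexP => // -> _.
  exists (local_cycle d z ++ r), z.1.2, z.2; rewrite !vertex_cat // vE.
  split=> //; case: (z) fz => [[[j|] k] b] //= fj.
  by rewrite fresh_cat // fj.
move=> t [c [k [b [vc vE aE _]]]].
(* The cycle on which the edge lies is one of the candidates. *)
have [o [cE fo]] : exists o, c = local_cycle d (o, k, b) ++ r /\
    (if o is Some j then fresh d j else true) = true.
  move: vE vc; case: vertexP => [_|-> _|p c' m -> _] vE.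
  - case: vd vE => [[-> dE]|[p ->] [_ <-]]; last by exists None.
    by rewrite dE in dr; rewrite (eqP dr).
  - by case: vd vE => [[-> ->]|[p ->] //] /= -> _; exists None.
  - case: vd vE => [[-> dE]|[q ->] [_ <-] /= /andP[fp _]].
      by rewrite dE /= in dr; rewrite (eqP dr).
    by exists (Some p); rewrite -(fresh_cat _ dr).
have e : vertex (local_cycle d (o, k, b)) k ++ r = v ++ r.
  by rewrite -vertex_cat -?cE.
have /eqP := congr1 size e; rewrite !size_cat eqn_add2r => /eqP sz.
move/eqP: e; rewrite eqseq_cat // eqxx andbT => e.
by move/negbT: (none (o, k, b)); rewrite fo e aE eqxx.
Qed.

(** The stack ends with [None], so that the automaton can tell when [d] is
    empty, and state [None] stands for the root. *)
Definition tree_conf v : option I * seq (option I) :=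
  (ohead v, rcons (map Some (behead v)) None).

Definition tree_move (q : option I) a (g : option I) :=
  let d := if g is Some h then [:: h] else [::] in
  let v := if q is Some p then p :: d else d in
  omap (fun t => (ohead t,
    if g is Some _ then map Some (behead t)
    else rcons (map Some (behead t)) None))
    (local_edge d v a).

Lemma tree_move_conf v : walk edge v w v ->
  exists (g : option I) (s : seq (option I)),
  (tree_conf v).2 = g :: s /\
  forall a, if tree_move (tree_conf v).1 a g is Some r
            then exists2 t, edge v a t & tree_conf t = (r.1, r.2 ++ s)
            else forall t, ~ edge v a t.
Proof.
move/loop_valid; case: v => [|p [|h v]] vv.
- exists None, [::]; split=> // a.
  have := @local_edgeP [::] [::] [::] a isT (or_introl (conj erefl erefl)) vv.
  rewrite /tree_move /=; case: local_edge => [t [et _]|//] /=.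
  by exists t; rewrite cats0 in et *; rewrite /tree_conf ?cats0.
- exists None, [::]; split=> // a.
  have := @local_edgeP [::] [:: p] [::] a isT
    (or_intror (ex_intro _ p erefl)) vv.
  rewrite /tree_move /=; case: local_edge => [t [et _]|//] /=.
  by exists t; rewrite cats0 in et *; rewrite /tree_conf ?cats0.
- exists (Some h), (rcons (map Some v) None); split=> // a.
  have := @local_edgeP [:: h] [:: p; h] v a isT
    (or_intror (ex_intro _ p erefl)) vv.
  rewrite /tree_move /=; case: local_edge => [t [et]|//] /=.
  exists (t ++ v) => //.
  case: t b et => [/= /eqP->|m t] //= _ _.
  by rewrite /tree_conf /= map_cat rcons_cat.
Qed.

Theorem tree_deterministic_context_free :
  deterministic_context_free (fun u : word X => inv_pres_eq w u [::]) /\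
  deterministic_context_free (fun u : word X => greenR w u [::]).
Proof.
apply: (@graph_deterministic_context_free X (seq I) edge edge_fun edge_inv w
  [::] tree_word _ _ _ _ _ _ None None tree_move tree_conf) => //.
- by move=> v a t /edge_valid; apply: valid_loop.
- exact: valid_loop.
- exact: edge_tree_word.
- exact: tree_move_conf.
- by case.
Qed.
End TreeOfCycles.

(** * Arcs glued in a sparse word *)

Section Arcs.
Local Open Scope ring_scope.
Variables (X : finType) (w : word X) (x0 : letter X).
Hypothesis n_gt1 : (1 < size w)%N.
Local Notation n := (size w).
Local Notation I := 'Z_n.
Local Notation label := (@label X w x0).
Local Notation sgn := (@sgn X w).
Implicit Types (p m k j h : I) (b : bool) (q : ctriple n) (r i : nat).

(** The cyclic subword of length [r] that starts at [p] in direction [b]. *)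
Definition arc_triple p b r : ctriple n := CTriple p (p + sgn b * r%:R) b.

Lemma ceps_sgn q : (ceps q)%:~R = sgn (cpos q) :> I.
Proof. by rewrite /ceps; case: (cpos q); rewrite ?mulrNz. Qed.

Lemma clength_arc p b r : (r < n)%N -> clength (arc_triple p b r) = r.
Proof.
move=> rn; rewrite /clength /=; case: b; rewrite /sgn.
  by rewrite mul1r addrC addKr val_natZ.
by rewrite mulN1r opprB addrC subrK val_natZ.
Qed.

Lemma nth_rotZ p i : (i < n)%N -> nth x0 (rot p w) i = nth x0 w (p + i%:R)%R.
Proof.
move=> iN; have -> : ((p + i%:R)%R : nat) = ((p + i) %% n)%N.
  by rewrite -{1}[p]natr_Zp -natrD val_Zp_nat.
have pn := ltn_Z n_gt1 p.
rewrite /rot nth_cat size_drop nth_drop; case: ltnP => h.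
  by rewrite modn_small //; lia.
have -> : (p + i = i - (n - p) + n)%N by lia.
by rewrite modnDr modn_small ?nth_take //; lia.
Qed.

Lemma cword_arc p b r : (r < n)%N ->
  cword (arc_triple p b r) = mkseq (fun i => label (p + sgn b * i%:R) b) r.
Proof.
move=> rn; have -> : cword (arc_triple p b r) = if b then take r (rot p w)
    else inv_word (take r (rot (p + sgn b * r%:R)%R w)).
  by rewrite /cword clength_arc.
case: b; rewrite /sgn /label.
  apply: (@eq_from_nth _ x0) => [|i].
    by rewrite size_mkseq size_take size_rot rn.
  rewrite size_take size_rot rn => ir; rewrite nth_mkseq // nth_take //.
  by rewrite mul1r nth_rotZ // (ltn_trans ir).
have sz : size (take r (rot (p + -1 * r%:R)%R w)) = r.
  by rewrite size_take size_rot rn.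
apply: (@eq_from_nth _ x0) => [|i]; rewrite /inv_word size_rev size_map sz.
  by rewrite size_mkseq.
move=> ir; have jr : (r - i.+1 < r)%N by lia.
rewrite nth_rev ?size_map ?sz // (nth_map x0) ?sz //.
rewrite nth_mkseq // nth_take // nth_rotZ ?(ltn_trans jr) //.
congr (inv_letter (nth x0 w _)); congr (nat_of_ord _).
by rewrite natrB // -natr1 !mulN1r -!addrA addKr opprD.
Qed.

Lemma zoneP q x : reflect
  (exists2 i, (i <= clength q)%N & x = cstart q + sgn (cpos q) * i%:R)
  (x \in zone q).
Proof.
apply: (iffP imsetP) => [[i _ ->]|[i iq ->]].
  by exists i; rewrite ?ceps_sgn // -ltnS ltn_ord.
by exists (Ordinal (iq : (i < _.+1)%N)) => //; rewrite ceps_sgn.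
Qed.

Lemma cstart_zone q : cstart q \in zone q.
Proof. by apply/zoneP; exists 0; rewrite ?mulr0 ?addr0. Qed.


Lemma zone_arc p b r x : (r < n)%N -> reflect
  (exists2 i, (i <= r)%N & x = p + sgn b * i%:R)
  (x \in zone (arc_triple p b r)).
Proof. by move=> rn; rewrite -{1}(clength_arc p b rn); apply: zoneP. Qed.

Hypothesis sparse_w : sparse w.

Lemma pair_disjoint q1 q1' q2 q2' x : sparse_pair q1 q1' ->
  sparse_pair q2 q2' -> x \in zone q1 -> x \notin zone q2'.
Proof.
case: sparse_w => _ _ sp s1 s2 x1; have [[e _] _] := sp _ _ _ _ s1 s2.
by apply/negP => x2; move/setP/(_ x): e; rewrite !inE x1 x2.
Qed.

Lemma pair_same_fold q1 q1' q2 q2' x : sparse_pair q1 q1' ->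
  sparse_pair q2 q2' -> x \in zone q1 -> x \in zone q2 ->
  ceps q1 * ceps q1' = ceps q2 * ceps q2' /\ coffset q1 q1' = coffset q2 q2'.
Proof.
case: sparse_w => _ _ sp s1 s2 x1 x2; have [_ [e|//]] := sp _ _ _ _ s1 s2.
by move/setP/(_ x): e; rewrite !inE x1 x2.
Qed.

Lemma sgn_neq0 b : sgn b != 0.
Proof.
apply/eqP => e; have := sgn_sq w b; rewrite e mul0r => /eqP.
by rewrite eq_sym oner_eq0.
Qed.

Lemma arc_triple_pair p p' b b' r : (0 < r < n)%N ->
  (forall i, (i < r)%N ->
    label (p + sgn b * i%:R) b = label (p' + sgn b' * i%:R) b') ->
  zone (arc_triple p b r) <> zone (arc_triple p' b' r) ->
  0 \in zone (arc_triple p' b' r) ->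
  sparse_pair (arc_triple p b r) (arc_triple p' b' r).
Proof.
move=> /andP[r0 rn] e z z0.
have cyc p1 b1 : cyclic_subword (arc_triple p1 b1 r).
  by rewrite /cyclic_subword clength_arc // r0; lia.
split=> //; rewrite !cword_arc //.
by apply/eq_in_map => i; rewrite mem_iota => /e.
Qed.

(** Inside the word this is free reduction.  A cancellation between the last
    and the first letter would give equal cyclic subwords of length 1 that
    start at 0 in both directions, contrary to (sparse 1); for n = 2 it is
    covered by free reduction again, as the letters cancel in either order. *)
Lemma label_inj k : injective (label k).
Proof.
suff neq : label k true != label k false.
  by move=> [] [] // e; move: neq; rewrite e eqxx.
have [red _ _] := sparse_w.
have redi i : (i.+1 < n)%N -> nth x0 w i.+1 != inv_letter (nth x0 w i).
  by move/(sortedP x0): red => red i1; apply: red.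
have [k0|k0] := eqVneq k 0; last first.
  have kp : (0 < k)%N by rewrite lt0n.
  rewrite /label.
  have -> : ((k - 1)%R : nat) = k.-1.
    have := val_succ n_gt1 (k - 1); rewrite subrK.
    have := ltn_Z n_gt1 (k - 1).
    rewrite leq_eqVlt => /orP[/eqP->|lt]; first by rewrite modnn; lia.
    by rewrite modn_small // => ->.
  rewrite -{1}(prednK kp) redi // prednK //.
  exact: ltn_Z n_gt1 k.
have [n2|n2] := leqP n 2.
  have e2 : (0 - 1 : I) = 1 :> nat.
    have := val_succ n_gt1 (0 - 1); rewrite subrK.
    have := ltn_Z n_gt1 (0 - 1); move: (nat_of_ord (0 - 1)) => i.
    case: i => [|[|i]] //; first by rewrite modn_small.
    by move=> i2; suff: (i.+2 < 2)%N by []; apply: leq_trans n2.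
  rewrite k0 /label e2 eq_sym -(inj_eq (inv_inj (@inv_letterK X))) inv_letterK.
  by apply: redi.
apply/eqP => e; rewrite k0 in e.
have sp : sparse_pair (arc_triple 0 true 1) (arc_triple 0 false 1).
  apply: arc_triple_pair => //; [by case => // _; rewrite !mulr0 addr0| |].
    move=> ze; have : 1 \in zone (arc_triple 0 false 1).
      rewrite -ze; apply/zone_arc => //; exists 1%N => //.
      by rewrite mulr1 add0r.
    case/zone_arc => // -[|[|i]] // _; rewrite add0r ?mulr0 ?mulr1.
      by move/eqP; rewrite oner_eq0.
    by move=> e1; have /(_ true false e1) := sgn_inj n_gt1 n2.
  exact: (cstart_zone (arc_triple 0 false 1)).
have := pair_disjoint sp sp (cstart_zone (arc_triple 0 true 1)).
by rewrite (cstart_zone (arc_triple 0 false 1)).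
Qed.

Hypothesis not_square : n = 2%N -> nth x0 w 0 != nth x0 w 1.

Definition arc p b b' r := forall i, (i < r)%N ->
  label (p + sgn b * i%:R) b = label (sgn b' * i%:R) b'.

Definition arc_pair p b b' r :=
  sparse_pair (arc_triple p b r) (arc_triple 0 b' r).

(** The zones [{p, p + sgn b}] and [{0, sgn b'}] coincide only if
    [p = sgn b'] is also [- sgn b].  Then either the two steps traverse one
    edge in opposite directions, and a letter would be its own inverse, or
    n = 2 and the steps go in the same direction, and [w] would be a square. *)
Lemma step_pair p b b' : p != 0 -> label p b = label 0 b' -> arc_pair p b b' 1.
Proof.
move=> p0 e; apply: arc_triple_pair => //; last first.
- exact: (cstart_zone (arc_triple 0 b' 1)).
- move=> ze.
  have /zone_arc : p \in zone (arc_triple 0 b' 1).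
    by rewrite -ze (cstart_zone (arc_triple p b 1)).
  case=> // -[|[|i]] // _; rewrite add0r ?mulr0 ?mulr1 => pE.
    by rewrite pE eqxx in p0.
  have /zone_arc : 0 \in zone (arc_triple p b 1).
    by rewrite ze (cstart_zone (arc_triple 0 b' 1)).
  case=> // -[|[|i]] // _; rewrite ?mulr0 ?addr0 ?mulr1 => p1.
    by rewrite -p1 eqxx in p0.
  have bb' : b' <> ~~ b.
    move=> bb'; have := label_back x0 p b.
    rewrite -p1 -bb' -e => /eqP.
    by rewrite eq_sym (negPf (inv_letter_neq _)).
  have /eqP eb : b' == b by case: (b) (b') bb' => [] [].
  have [n2|n2] := leqP n 2; last first.
    case: bb'; apply: sgn_inj n2 _ _ _ => //.
    by rewrite sgnN -pE; apply/eqP; rewrite -addr_eq0 -p1.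
  have /not_square : n = 2%N by apply/eqP; rewrite eqn_leq n2.
  have p1n : p = 1%N :> nat.
    have := lt0n p; rewrite p0; have := ltn_Z n_gt1 p; lia.
  rewrite eb in e pE; case/eqP; move: e p1 pE; rewrite /label; case: (b).
    by rewrite p1n.
  move=> /(inv_inj (@inv_letterK X)) e p1 pE; move: e; rewrite -p1 sub0r.
  by rewrite -[- 1]pE p1n.
- by move=> [|i] //; rewrite !mulr0 !addr0.
Qed.

Lemma arc_prefix p b b' r s : (s <= r)%N -> arc p b b' r -> arc p b b' s.
Proof. by move=> sr e i si; apply: e; apply: leq_trans sr. Qed.

(** By (sparse 1) for a sparse pair and itself, the two zones are disjoint.
    This makes induction on [r] possible: disjoint zones of [r + 1] positions
    do not fill the cycle, and after one more letter they still differ,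
    because [p] and [p + sgn b] cannot both be the position added to the other
    zone. *)
Lemma arc_is_pair p b b' r : p != 0 -> (0 < r)%N -> arc p b b' r ->
  (r < n)%N /\ arc_pair p b b' r.
Proof.
move=> p0; case: r => // r _; elim: r => [|r IHr] e.
  split=> //; apply: step_pair => //.
  by have := e 0%N isT; rewrite !mulr0 !addr0.
have [rn sp] := IHr (arc_prefix (leqnSn _) e).
have disj := pair_disjoint sp sp.
have z0 := cstart_zone (arc_triple 0 b' r.+1).
have r1n : (r.+2 < n)%N.
  rewrite ltn_neqAle rn andbT; apply/eqP => rE.
  (* The length at which an arc from [p] in direction [b] reaches 0. *)
  pose i : I := - (sgn b * p).
  have ir : (i <= r.+1)%N by rewrite -ltnS rE ltn_Z.
  have /disj : 0 \in zone (arc_triple p b r.+1); last by rewrite z0.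
  apply/zone_arc => //; exists i => //.
  by rewrite natr_Zp /i mulrN mulrA sgn_sq mul1r subrr.
split=> //; apply: arc_triple_pair => //.
- by move=> i /e; rewrite add0r.
- move=> ze.
  have pz : p \in zone (arc_triple 0 b' r.+2).
    by rewrite -ze (cstart_zone (arc_triple p b r.+2)).
  have old x : x \in zone (arc_triple 0 b' r.+2) ->
      x \in zone (arc_triple p b r.+1) -> x = sgn b' * r.+2%:R.
    case/zone_arc=> // i; rewrite add0r leq_eqVlt => /orP[/eqP-> //|ir] xE.
    move/disj/negP; case; apply/zone_arc => //.
    by exists i; rewrite ?add0r.
  have pE := old p pz (cstart_zone (arc_triple p b r.+1)).
  have p1z : p + sgn b \in zone (arc_triple 0 b' r.+2).
    by rewrite -ze; apply/zone_arc => //; exists 1%N; rewrite ?mulr1.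
  have p1z' : p + sgn b \in zone (arc_triple p b r.+1).
    by apply/zone_arc => //; exists 1%N; rewrite ?mulr1.
  have /eqP := old _ p1z p1z'.
  by rewrite -pE -subr_eq0 addrAC subrr add0r (negPf (sgn_neq0 b)).
- exact: (cstart_zone (arc_triple 0 b' r.+2)).
Qed.

(** As [w] is cyclically reduced, a common step of the two cycles either
    extends both arcs or retracts both. *)
Lemma glued_arc p m k : glued x0 p m k -> exists b b' r,
  [/\ arc p b b' r, m = p + sgn b * r%:R & k = sgn b' * r%:R].
Proof.
pose on_arc (y : I * I) := exists b b' r,
  [/\ arc p b b' r, y.1 = p + sgn b * r%:R & y.2 = sgn b' * r%:R].
apply: (connect_preserves (P := on_arc)); last first.
  by exists true, true, 0%N; split; rewrite //= !mulr0 ?addr0.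
rewrite /on_arc => y z /same_stepP[c [c' [e -> ->]]] [b [b' [[|r] [ar y1 y2]]]].
  rewrite y1 y2 !mulr0 addr0 in e *; exists c, c', 1%N.
  by split; rewrite ?mulr1 ?add0r // => -[|i] // _; rewrite !mulr0 addr0.
have succE b1 : sgn b1 * r.+1%:R = sgn b1 * r%:R + sgn b1 :> I.
  by rewrite -natr1 mulrDr mulr1.
have back : label y.1 (~~ b) = label y.2 (~~ b').
  by rewrite y1 y2 !succE addrA !label_back ar.
have [cb|cb] := eqVneq c b; last first.
  have {cb} cb : c = ~~ b by case: (c) (b) cb => [] [].
  have c'b' : c' = ~~ b' by rewrite cb back in e; rewrite (label_inj e).
  exists b, b', r; split; first exact: arc_prefix ar.
    by rewrite y1 cb succE sgnN addrA addrK.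
  by rewrite y2 c'b' succE sgnN addrK.
have c'b' : c' = b'.
  apply/eqP; case: eqP => // ne; have {ne} c'b' : c' = ~~ b'.
    by case: (c') (b') ne => [] [].
  by move: e; rewrite c'b' -back cb => /label_inj; case: (b).
exists b, b', r.+2; split; last 2 first.
- by rewrite y1 cb -[in RHS]natr1 mulrDr mulr1 addrA.
- by rewrite y2 c'b' -[in RHS]natr1 mulrDr mulr1.
- move=> i; rewrite ltnS leq_eqVlt => /orP[/eqP->|/ar //].
  by rewrite -y1 -y2 -cb -c'b'.
Qed.

(** For [m = p] the arc is trivial and gives no cyclic subword; an arc of
    length 1 along the seam takes its place. *)
Lemma glued_pair p m k : p != 0 -> seam x0 p -> glued x0 p m k ->
  exists q q', [/\ sparse_pair q q', m \in zone q, k \in zone q',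
    p \in zone q & coffset q q' = p /\ k = (ceps q * ceps q')%:~R * (m - p)].
Proof.
move=> p0 sp /glued_arc[b [b' [r [ar mE kE]]]].
have off c c' s : coffset (arc_triple p c s) (arc_triple 0 c' s) = p.
  by rewrite /coffset mulr0 subr0.
have [r0|r0] := posnP r.
  have /seamP[c [c' /(step_pair p0) pr]] := sp.
  exists (arc_triple p c 1), (arc_triple 0 c' 1).
  rewrite mE kE r0 !mulr0 addr0 subrr mulr0; split=> //.
  - exact: (cstart_zone (arc_triple p c 1)).
  - exact: (cstart_zone (arc_triple 0 c' 1)).
  - exact: (cstart_zone (arc_triple p c 1)).
have [rn pr] := arc_is_pair p0 r0 ar.
exists (arc_triple p b r), (arc_triple 0 b' r); split=> //.
- by apply/zone_arc => //; exists r.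
- by apply/zone_arc => //; exists r; rewrite ?add0r.
- exact: (cstart_zone (arc_triple p b r)).
- split=> //; rewrite intrM !ceps_sgn mE kE addrAC subrr add0r.
  by rewrite mulrAC mulrA sgn_sq mul1r mulrC.
Qed.

(** By (sparse 2), applied at [p], the cycle attached at [p] is glued with one
    orientation [s] on both sides of [p]. *)
Lemma sparse_glued_sign p m m' k k' :
  p != 0 -> glued x0 p m k -> glued x0 p m' k' ->
  exists2 s : I, s * s = 1 & k = s * (m - p) /\ k' = s * (m' - p).
Proof.
move=> p0 g g'; have [sp|np] := boolP (seam x0 p); last first.
  have [-> ->] := glued_no_seam g np; have [-> ->] := glued_no_seam g' np.
  by exists 1; rewrite ?mulr1 // subrr mulr0.
have [q1 [q1' [s1 _ _ p1 [_ kE]]]] := glued_pair p0 sp g.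
have [q2 [q2' [s2 _ _ p2 [_ kE']]]] := glued_pair p0 sp g'.
have [eps _] := pair_same_fold s1 s2 p1 p2.
exists (ceps q1 * ceps q1')%:~R; last by rewrite kE kE' eps.
by rewrite intrM !ceps_sgn mulrACA !sgn_sq mulr1.
Qed.

Theorem sparse_deterministic_context_free :
  deterministic_context_free (fun u : word X => inv_pres_eq w u [::]) /\
  deterministic_context_free (fun u : word X => greenR w u [::]).
Proof.
apply: (@tree_deterministic_context_free X w x0 n_gt1 label_inj).
- move=> p m m' k p0 g g'.
  have [s ss [-> /(congr1 (fun x => s * x))]] := sparse_glued_sign p0 g g'.
  by rewrite !mulrA ss !mul1r => /addIr.
- move=> p m k k' p0 g g'.
  by have [s _ [-> ->]] := sparse_glued_sign p0 g g'.
- move=> p m k p0 g; have [sp|np] := boolP (seam x0 p); last first.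
    by have [-> _] := glued_no_seam g np.
  have [q [q' [s mq _ _ _]]] := glued_pair p0 sp g.
  have := pair_disjoint s s mq; apply: contra => /eqP->.
  by case: s.
- move=> p p' m k m' p0 p0' sp sp' g g'.
  have [q1 [q1' [s1 m1 _ _ _]]] := glued_pair p0 sp g.
  have [q2 [q2' [s2 _ m2 _ _]]] := glued_pair p0' sp' g'.
  by have := pair_disjoint s1 s2 m1; rewrite m2.
- move=> p p' m k k' p0 p0' sp sp' g g'.
  have [q1 [q1' [s1 m1 _ _ [o1 _]]]] := glued_pair p0 sp g.
  have [q2 [q2' [s2 m2 _ _ [o2 _]]]] := glued_pair p0' sp' g'.
  by have [_] := pair_same_fold s1 s2 m1 m2; rewrite o1 o2.
Qed.
End Arcs.

(** * The square of a letter, and the theorem *)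

Section Square.
Variables (X : finType) (a : letter X).
Local Notation w := [:: a; a].

Lemma letter_cases (b : letter X) : b.1 = a.1 -> b = a \/ b = inv_letter a.
Proof.
case: a b => x s [y t] /= ->.
by have [->|] := eqVneq s t; [left | case: s t => [] []; right].
Qed.

(** [a^-1 = (a a) a^-1 = a]: cancelling on the right is backtracking. *)
Lemma square_inverse : inv_pres_eq w [:: inv_letter a] [:: a].
Proof.
have aa : right_invertible w ([:: a] ++ [:: a]).
  by exists [::]; apply: equiv_relator.
apply: gc_trans (backtrack aa).
exact: (equiv_catr [:: inv_letter a] (gc_sym (equiv_relator w))).
Qed.

Theorem square_deterministic_context_free :
  deterministic_context_free (fun u : word X => inv_pres_eq w u [::]) /\
  deterministic_context_free (fun u : word X => greenR w u [::]).
Proof.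
pose flip (v : bool) (b : letter X) t := b.1 = a.1 /\ t = ~~ v.
have loop v : walk flip v w v.
  by exists (~~ v) => //; exists v => //; rewrite /flip negbK.
apply: (@graph_deterministic_context_free X bool flip _ _ w false
  (fun v => if v then [:: a] else [::]) _ _ _ _ bool unit false tt
  (fun q b _ => if b.1 == a.1 then Some (~~ q, [:: tt]) else None)
  (fun v => (v, [:: tt]))) => //.
- by move=> v b t t' [_ ->] [_ ->].
- by move=> v b t [e ->]; rewrite /flip negbK.
- move=> [] b t [/letter_cases[]-> ->] /=.
  + exact: equiv_relator.
  + apply: gc_trans (equiv_relator w).
    exact: (equiv_catl [:: a] square_inverse).
  + exact: gc_refl.
  + exact: square_inverse.
- move=> v _; exists tt, [::]; split=> // b.
  case: eqP => [e|ne t [] //].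
  by exists (~~ v).
Qed.
End Square.

Theorem theorem1p3 (X : finType) (w : word X) (hw : sparse w) :
  deterministic_context_free (fun u : word X => inv_pres_eq w u [::]) /\
  deterministic_context_free (fun u : word X => greenR w u [::]).
Proof.
case: (hw) => _ n_gt1 _.
have [x0] : exists x0 : letter X, True.
  by case: (w) n_gt1 => // x s _; exists x.
move=> _.
have [/andP[/eqP n2 /eqP e]|ns] :=
    boolP ((size w == 2) && (nth x0 w 0 == nth x0 w 1)).
  case: w n2 e {hw n_gt1} => [|a [|b []]] //= _ <-.
  exact: square_deterministic_context_free.
apply: (sparse_deterministic_context_free (x0 := x0) n_gt1 hw) => n2.
by rewrite n2 eqxx in ns.
Qed.
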